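(* Let $G$ be a connected graph of order $n\geq 4$ with edge connectivity $k'$. Then $$ASO(G)\leq k'\sqrt{\frac{(n-1)^2+k'^2}{n+k'-3}}+\binom{k'}{2}\sqrt{n+\frac{1}{n-2}}+k'(n-k'-1)\sqrt{n-\frac{1}{2}+\frac{5}{2(2n-5)}}+\binom{n-k'-1}{2}\sqrt{n-1+\frac{1}{n-3}},$$ with equality if and only if $G\cong (K_1\cup K_{n-k'-1})\vee K_{k'}$ when $k'\leq n-2$, and $G\cong K_n$ when $k'=n-1$.
   Context: All graphs are finite and simple. The edge connectivity of a connected graph is the minimum number of edges whose deletion disconnects the graph (for $K_n$ it equals $n-1$). $K_m$ is the complete graph on $m$ vertices; $G\cup H$ is the disjoint union of vertex-disjoint graphs $G,H$; the join $G\vee H$ is obtained from $G\cup H$ by adding all edges between every vertex of $G$ and every vertex of $H$. For a graph $G$ with no connected component isomorphic to $P_2$, the augmented Sombor index is $ASO(G)=\sum_{v_iv_j\in E(G)}\sqrt{\frac{d_i^2+d_j^2}{d_i+d_j-2}}$, where $d_i$ is the degree of $v_i$ in $G$. *)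

(* Defs.v *)
From HB Require Import structures.
From mathcomp Require Export all_boot all_order all_algebra reals.

Set Implicit Arguments.
Unset Strict Implicit.
Unset Printing Implicit Defensive.

Import Order.TTheory GRing.Theory Num.Theory.

Record sgraph := SGraph {
  vertex :> finType;
  adj : rel vertex;
  adj_sym : symmetric adj;
  adj_irr : irreflexive adj
}.

Definition edges (G : sgraph) : {set {set G}} :=
  [set [set p.1; p.2] | p in [set p : G * G | adj p.1 p.2]].

Definition degree (G : sgraph) (x : G) : nat := #|[set y | adj x y]|.

Definition connected (G : sgraph) : bool :=
  (0 < #|G|)%N && [forall x : G, forall y : G, connect (@adj G) x y].

Section DeleteEdges.
Variables (G : sgraph) (F : {set {set G}}).

Definition del_adj : rel G :=
  fun x y => adj x y && ([set x; y] \notin F).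

Lemma del_adj_sym : symmetric del_adj.
Proof. by move=> x y; rewrite /del_adj adj_sym setUC. Qed.

Lemma del_adj_irr : irreflexive del_adj.
Proof. by move=> x; rewrite /del_adj adj_irr. Qed.

Definition del_edges : sgraph := SGraph del_adj_sym del_adj_irr.
End DeleteEdges.

Definition disconnecting (G : sgraph) (F : {set {set G}}) : bool :=
  (F \subset edges G) && ~~ connected (del_edges F).

(* Deleting all edges disconnects any graph with at least two vertices, so   *)
(* [edges G] is an admissible starting point of the minimisation.            *)
Definition edge_connectivity (G : sgraph) : nat :=
  #|[arg min_(F < edges G | disconnecting F) #|F|]|.

Section Complete.
Variable m : nat.

Definition complete_adj : rel 'I_m := fun x y => x != y.

Lemma complete_adj_sym : symmetric complete_adj.
Proof. by move=> x y; rewrite /complete_adj eq_sym. Qed.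

Lemma complete_adj_irr : irreflexive complete_adj.
Proof. by move=> x; rewrite /complete_adj eqxx. Qed.

Definition complete : sgraph := SGraph complete_adj_sym complete_adj_irr.
End Complete.

Section UnionJoin.
Variables G H : sgraph.

Definition sum_adj (b : bool) : rel (G + H)%type := fun u v =>
  match u, v with
  | inl x, inl y => adj x y
  | inr x, inr y => adj x y
  | _, _ => b
  end.

Lemma sum_adj_sym b : symmetric (sum_adj b).
Proof. by case=> x [] y //=; rewrite adj_sym. Qed.

Lemma sum_adj_irr b : irreflexive (sum_adj b).
Proof. by case=> x /=; rewrite adj_irr. Qed.

Definition gunion : sgraph := SGraph (sum_adj_sym false) (sum_adj_irr false).
Definition gjoin : sgraph := SGraph (sum_adj_sym true) (sum_adj_irr true).
End UnionJoin.

Definition giso (G H : sgraph) : Prop :=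
  exists2 f : G -> H, bijective f & forall x y, adj (f x) (f y) = adj x y.

Local Open Scope ring_scope.

(* An edge is the set of its two endpoints, so the inner sums over [A] are   *)
(* d_i^2 + d_j^2 and d_i + d_j. A component isomorphic to P_2 would give a   *)
(* zero denominator, and so (as 0^-1 = 0) a zero summand.                    *)
Definition ASO (R : realType) (G : sgraph) : R :=
  \sum_(A in edges G)
    Num.sqrt ((\sum_(x in A) (degree x)%:R ^+ 2) /
              ((\sum_(x in A) (degree x)%:R) - 2)).

(* Main.v *)
Require Import Defs.
From mathcomp Require Import ring lra zify.

(* If some vertex v has degree k', then G is a spanning subgraph of the graph in
   which v keeps its neighbours and all other vertices are pairwise adjacent.
   Adding an edge uw strictly increases ASO: raising one endpoint degree from d
   to d + 1 lowers the weight of an edge by at most 1 / (2 sqrt d), so the d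
   edges at an endpoint lose at most sqrt d / 2 in total, and the new edge has
   weight greater than (sqrt d_u + sqrt d_w) / 2.
   If no vertex has degree k', a minimum edge cut has at least k' + 2 vertices
   on each side, so that all degrees lie in [2, n - 3]. Then every edge has weight
   at most sqrt (n - 1) and there are at most n (n - 3) / 2 edges, whereas the
   bound is at least binom(n - 1, 2) sqrt (n - 1). *)

Set Implicit Arguments.
Unset Strict Implicit.
Unset Printing Implicit Defensive.

Import Order.TTheory GRing.Theory Num.Theory.
Local Open Scope ring_scope.

(** * Estimates for the weight of an edge with given endpoint degrees *)

Section Weight.
Variable R : realType.

Definition weight (a b : nat) : R :=
  Num.sqrt ((a%:R ^+ 2 + b%:R ^+ 2) / (a%:R + b%:R - 2)).

Lemma weightC a b : weight a b = weight b a.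
Proof. by rewrite /weight addrC [b%:R + _]addrC. Qed.

Lemma weight_ge0 a b : 0 <= weight a b.
Proof. exact: sqrtr_ge0. Qed.

(** Squaring the right side gives at least [q + 1], because the cross term is
    [sqrt q / sqrt x >= 1]. *)
Lemma sqrt_drop (p q x : R) :
  0 < x -> x <= q -> p <= q + 1 ->
  Num.sqrt p <= Num.sqrt q + (2 * Num.sqrt x)^-1.
Proof.
move=> x0 xq pq.
have sx : 0 < Num.sqrt x by rewrite sqrtr_gt0.
have i0 : 0 < (2 * Num.sqrt x)^-1 by rewrite invr_gt0 mulr_gt0.
have sq : Num.sqrt x <= Num.sqrt q by rewrite ler_wsqrtr.
have q0 : 0 <= q by lra.
rewrite -[leRHS]ger0_norm; last by rewrite addr_ge0 ?sqrtr_ge0 // ltW.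
rewrite -sqrtr_sqr ler_wsqrtr // sqrrD sqr_sqrtr //.
have : 1 <= Num.sqrt q * (2 * Num.sqrt x)^-1 *+ 2.
  have -> : Num.sqrt q * (2 * Num.sqrt x)^-1 *+ 2 = Num.sqrt q / Num.sqrt x.
    by field; rewrite gt_eqF.
  by rewrite ler_pdivlMr // mul1r.
have := sqr_ge0 (2 * Num.sqrt x)^-1.
lra.
Qed.

(** If [b <= a], raising [a] does not lower the weight at all. If [a <= b], the radicand drops by at
    most 1 and stays at least [a], so [sqrt_drop] applies with [x = a]. *)
Lemma weight_drop (a b : nat) : (0 < a)%N -> (0 < b)%N -> (3 <= a + b)%N ->
  weight a b <= weight a.+1 b + (2 * Num.sqrt a%:R)^-1.
Proof.
move=> a0 b0 ab3; rewrite /weight -(natr1 a).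
have x1 : 1 <= a%:R :> R by rewrite ler1n.
have y1 : 1 <= b%:R :> R by rewrite ler1n.
have s1 : 3 <= a%:R + b%:R :> R by rewrite -natrD ler_nat.
have [ba|/ltnW ab] := leqP b a.
  have x2 : 2 <= a%:R :> R by rewrite ler_nat; lia.
  have yx : b%:R <= a%:R :> R by rewrite ler_nat.
  apply: (le_trans (y := Num.sqrt (((a%:R + 1) ^+ 2 + b%:R ^+ 2) / (a%:R + 1 + b%:R - 2)))).
    rewrite ler_wsqrtr // ler_pdivrMr; last lra.
    rewrite mulrAC ler_pdivlMr; last lra.
    nra.
  by rewrite lerDl invr_ge0 mulr_ge0 // sqrtr_ge0.
have y2 : 2 <= b%:R :> R by rewrite ler_nat; lia.
have yx : a%:R <= b%:R :> R by rewrite ler_nat.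
apply: sqrt_drop; first lra.
  rewrite ler_pdivlMr; last lra.
  nra.
rewrite -[X in _ <= _ + X](mulfV (x := a%:R + 1 + b%:R - 2)); last by apply: lt0r_neq0; lra.
rewrite -mulrDl ler_pdivrMr; last lra.
rewrite mulrAC ler_pdivlMr; last lra.
nra.
Qed.

(** The squared weight exceeds [(a + b) / 2], which is at least the square of
    [(sqrt a + sqrt b) / 2]. *)
Lemma weight_new_edge (a b : nat) : (0 < a)%N -> (0 < b)%N ->
  Num.sqrt a%:R + Num.sqrt b%:R < 2 * weight a.+1 b.+1.
Proof.
move=> a0 b0.
have x1 : 1 <= a%:R :> R by rewrite ler1n.
have y1 : 1 <= b%:R :> R by rewrite ler1n.
set w := weight _ _.
have w2 : w ^+ 2 = ((a%:R + 1) ^+ 2 + (b%:R + 1) ^+ 2) / (a%:R + b%:R).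
  rewrite /w /weight -(natr1 a) -(natr1 b) sqr_sqrtr.
    congr (_ / _); lra.
  by apply: divr_ge0; [rewrite addr_ge0 ?sqr_ge0 | lra].
have w0 : 0 <= w by exact: weight_ge0.
have h : (a%:R + b%:R) / 2 < w ^+ 2.
  rewrite w2 ltr_pdivlMr; last lra.
  have := sqr_ge0 (a%:R - b%:R : R); nra.
have sa : Num.sqrt a%:R ^+ 2 = a%:R :> R by rewrite sqr_sqrtr.
have sb : Num.sqrt b%:R ^+ 2 = b%:R :> R by rewrite sqr_sqrtr.
have := sqrtr_ge0 (a%:R : R); have := sqrtr_ge0 (b%:R : R).
move: (Num.sqrt _) sa (Num.sqrt _) sb h => s sa t sb h t0 s0.
rewrite ltNge; apply/negP => hw.
have : (2 * w) ^+ 2 <= (s + t) ^+ 2 by rewrite ler_sqr ?nnegrE; lra.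
have := sqr_ge0 (s - t); nra.
Qed.

(* The chord bound [a^2 <= (D + 2) a - 2 D] on [2, D], added for [a] and [b]. *)
Lemma weight_le (a b D : nat) :
  (2 <= a <= D)%N -> (2 <= b <= D)%N -> weight a b <= Num.sqrt (D%:R + 2).
Proof.
move=> /andP[a2 aD] /andP[b2 bD].
have x2 : 2 <= a%:R :> R by rewrite ler_nat.
have xD : a%:R <= D%:R :> R by rewrite ler_nat.
have y2 : 2 <= b%:R :> R by rewrite ler_nat.
have yD : b%:R <= D%:R :> R by rewrite ler_nat.
rewrite ler_wsqrtr // ler_pdivrMr; last lra.
have : 0 <= (a%:R - 2) * (D%:R - a%:R) :> R by rewrite mulr_ge0 ?subr_ge0.
have : 0 <= (b%:R - 2) * (D%:R - b%:R) :> R by rewrite mulr_ge0 ?subr_ge0.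
nra.
Qed.

(** On [[D, D + 1]] one has [t^2 >= (D + 1) (t - 1)]; add this for [a] and [b]. It serves with
    [D = n - 2], for the edges of the extremal graph that avoid the vertex of degree [k]. *)
Lemma weight_ge (a b D : nat) : (0 < D)%N -> (D <= a <= D.+1)%N -> (D <= b <= D.+1)%N ->
  (3 <= a + b)%N -> Num.sqrt (D%:R + 1) <= weight a b.
Proof.
move=> D0 /andP[aD Da] /andP[bD Db] ab.
have x1 : D%:R <= a%:R :> R by rewrite ler_nat.
have x2 : a%:R <= D%:R + 1 :> R by rewrite natr1 ler_nat.
have y1 : D%:R <= b%:R :> R by rewrite ler_nat.
have y2 : b%:R <= D%:R + 1 :> R by rewrite natr1 ler_nat.
have ab3 : 3 <= a%:R + b%:R :> R by rewrite -natrD ler_nat.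
rewrite ler_wsqrtr // ler_pdivlMr; last lra.
nra.
Qed.

End Weight.

(** * Sums over ordered adjacent pairs, and the effect of adding edges *)

Section PairSum.
Variables (R : realType) (T : finType).
Implicit Types (e : rel T).

Definition rdeg e x : nat := #|[set y | e x y]|.

(** Each edge counts once per orientation, so this is twice [ASO]. Relations on a fixed vertex type
    allow edges to be added without changing the type. *)
Definition pair_sum e : R :=
  \sum_x \sum_(y | e x y) weight R (rdeg e x) (rdeg e y).

Definition add_pair e u v : rel T :=
  fun x y => [|| e x y, (x == u) && (y == v) | (x == v) && (y == u)].

Section AddPair.
Variables (e : rel T) (u v : T).
Hypotheses (es : symmetric e) (ei : irreflexive e).
Hypotheses (uv : u != v) (neuv : ~~ e u v).

Lemma add_pair_sym : symmetric (add_pair e u v).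
Proof.
move=> x y; rewrite /add_pair es.
by case: (x == u); case: (x == v); case: (y == u); case: (y == v).
Qed.

Lemma add_pair_irr : irreflexive (add_pair e u v).
Proof.
move=> x; rewrite /add_pair ei /=.
by case: (eqVneq x u) => [->|] //=; rewrite ?(negbTE uv) ?andbF.
Qed.

Lemma big_add_pair (F : T -> R) x :
  \sum_(y | add_pair e u v x y) F y =
  \sum_(y | e x y) F y + (if x == u then F v else 0) + (if x == v then F u else 0).
Proof.
have nevu : ~~ e v u by rewrite es.
rewrite /add_pair; case: (eqVneq x u) => [->|xu] /=.
  rewrite (negbTE uv) addr0 (bigD1 v) ?eqxx ?orbT //= addrC; congr (_ + _).
  apply: eq_bigl => y; rewrite orbF.
  by case: (eqVneq y v) => [->|_] /=; rewrite ?(negbTE neuv) ?andbF ?orbF ?andbT.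
case: (eqVneq x v) => [->|xv] /=; last first.
  by rewrite !addr0; apply: eq_bigl => y; rewrite orbF.
rewrite addr0 (bigD1 u) ?eqxx ?orbT //= addrC; congr (_ + _).
apply: eq_bigl => y.
by case: (eqVneq y u) => [->|_] /=; rewrite ?(negbTE nevu) ?andbF ?orbF ?andbT.
Qed.

Lemma rdegE (f : rel T) x : (rdeg f x)%:R = \sum_(y | f x y) (1 : R).
Proof. by rewrite sumr_const /rdeg cardsE. Qed.

Lemma rdeg_add_pair x :
  rdeg (add_pair e u v) x = (rdeg e x + (x == u) + (x == v))%N.
Proof.
apply/eqP; rewrite -(eqr_nat R) !natrD !rdegE big_add_pair.
by case: (x == u); case: (x == v).
Qed.

Hypothesis (dgt0 : forall x, (0 < rdeg e x)%N).
Hypothesis (dge3 : forall x y, e x y -> (3 <= rdeg e x + rdeg e y)%N).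

Lemma pair_sum_add_pair : pair_sum e < pair_sum (add_pair e u v).
Proof.
pose d := rdeg e; pose d1 := rdeg (add_pair e u v).
(* [c x] is the loss charged to each old edge at [x]; only [u] and [v] change degree. *)
pose c x : R := if (x == u) || (x == v) then (2 * Num.sqrt (d x)%:R)^-1 else 0.
have nevu : ~~ e v u by rewrite es.
have d1N x : x != u -> x != v -> d1 x = d x.
  by rewrite /d1 rdeg_add_pair => /negbTE-> /negbTE->; rewrite !addn0.
have d1u : d1 u = (d u).+1 by rewrite /d1 rdeg_add_pair eqxx (negbTE uv) addn0 addn1.
have d1v : d1 v = (d v).+1.
  by rewrite /d1 rdeg_add_pair eqxx eq_sym (negbTE uv) addn0 addn1.
(* As [u] and [v] are not adjacent in [e], at most one endpoint degree of an old edge rises. *)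
have neighborN x y : (x == u) || (x == v) -> e x y -> (y != u) && (y != v).
  case/orP=> /eqP-> exy; apply/andP; split; apply/eqP => E; move: exy.
  - by rewrite E ei.
  - by rewrite E (negbTE neuv).
  - by rewrite E (negbTE nevu).
  - by rewrite E ei.
have drop x y : (x == u) || (x == v) -> e x y ->
    weight R (d x) (d y) <= weight R (d1 x) (d1 y) + c x + c y.
  move=> xuv exy; have /andP[yu yv] := neighborN _ _ xuv exy.
  rewrite (d1N y yu yv) /c xuv (negbTE yu) (negbTE yv) /= addr0.
  have -> : d1 x = (d x).+1 by case/orP: xuv => /eqP->.
  by apply: weight_drop; rewrite /d ?dgt0 ?dge3.
have pointwise x y : e x y ->
    weight R (d x) (d y) <= weight R (d1 x) (d1 y) + (c x + c y).
  move=> exy; rewrite addrA.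
  have [xuv|xN] := boolP ((x == u) || (x == v)); first exact: drop.
  have [yuv|yN] := boolP ((y == u) || (y == v)).
    by rewrite weightC [weight _ (d1 x) _]weightC addrAC drop // es.
  rewrite /c (negbTE xN) (negbTE yN) !addr0.
  by move: xN yN; rewrite !negb_or => /andP[? ?] /andP[? ?]; rewrite !d1N.
have half (n : nat) : (0 < n)%N -> n%:R * (2 * Num.sqrt n%:R)^-1 = Num.sqrt n%:R / 2 :> R.
  move=> n0; have sn : 0 < Num.sqrt n%:R :> R by rewrite sqrtr_gt0 ltr0n.
  rewrite -{1}[n%:R]sqr_sqrtr //; field; exact: lt0r_neq0.
have sumc : \sum_x (d x)%:R * c x = (Num.sqrt (d u)%:R + Num.sqrt (d v)%:R) / 2.
  rewrite (bigD1 u) //= (bigD1 v) 1?eq_sym //= big1 ?addr0.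
    by rewrite /c !eqxx orbT /= !half /d ?dgt0 // mulrDl.
  by move=> x /andP[xu xv]; rewrite /c (negbTE xu) (negbTE xv) mulr0.
have sum1 : \sum_x \sum_(y | e x y) c x = \sum_x (d x)%:R * c x.
  by apply: eq_bigr => x _; rewrite sumr_const /d /rdeg cardsE mulr_natl.
have sum2 : \sum_x \sum_(y | e x y) c y = \sum_x (d x)%:R * c x.
  rewrite -sum1 (exchange_big_dep predT) //=.
  by apply: eq_bigr => y _; apply: eq_bigl => x; rewrite es.
(* Every edge occurs in both orders, so the charges at [u] and [v] enter twice and the factor 1/2
   disappears. *)
have upper : pair_sum e <=
    \sum_x \sum_(y | e x y) weight R (d1 x) (d1 y)
    + (Num.sqrt (d u)%:R + Num.sqrt (d v)%:R).
  apply: (@le_trans _ _ (\sum_x \sum_(y | e x y) (weight R (d1 x) (d1 y) + (c x + c y)))).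
    by apply: ler_sum => x _; apply: ler_sum => y; apply: pointwise.
  under eq_bigr do rewrite big_split big_split /=.
  rewrite big_split big_split /= sum1 sum2 sumc; lra.
have lower : pair_sum (add_pair e u v) =
    \sum_x \sum_(y | e x y) weight R (d1 x) (d1 y)
    + 2 * weight R (d u).+1 (d v).+1.
  rewrite /pair_sum -/d1; under eq_bigr do rewrite big_add_pair.
  rewrite !big_split /= -!big_mkcond !big_pred1_eq -addrA; congr (_ + _).
  by rewrite d1u d1v [X in _ + X]weightC mulr2n mulrDl mul1r.
rewrite lower; apply: le_lt_trans upper _; rewrite ltrD2l.
by apply: weight_new_edge; rewrite /d dgt0.
Qed.

End AddPair.

Lemma pair_sum_eq e e' : e =2 e' -> pair_sum e = pair_sum e'.
Proof.
move=> E; have D x : rdeg e x = rdeg e' x.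
  by apply: eq_card => y; rewrite !inE E.
by apply: eq_bigr => x _; rewrite (eq_bigl _ _ (E x)); apply: eq_bigr => y _; rewrite !D.
Qed.

(** Induction on the number of ordered pairs in [e'] but not in [e], adding one edge at a time. Old
    degrees do not fall and the ends of a new edge have degree at least 2, so both degree conditions
    persist. The dichotomy later yields the equality case. *)
Lemma pair_sum_subrel e e' :
  symmetric e -> irreflexive e -> symmetric e' -> irreflexive e' ->
  subrel e e' -> (forall x, (0 < rdeg e x)%N) ->
  (forall x y, e x y -> (3 <= rdeg e x + rdeg e y)%N) ->
  e =2 e' \/ pair_sum e < pair_sum e'.
Proof.
move=> es ei es' ei' sub d0 d3.
have [m] := ubnP #|[set p | e' p.1 p.2 && ~~ e p.1 p.2]|.
elim: m e es ei sub d0 d3 => // m IH e es ei sub d0 d3 cm.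
have [/existsP[p]|/existsPn N] := boolP [exists p, e' p.1 p.2 && ~~ e p.1 p.2]; last first.
  left=> x y; apply/idP/idP; first exact: sub.
  by move=> E; have := N (x, y); rewrite /= E negbK.
case: p => u v /= /andP[euv' neuv]; right.
have uv : u != v by apply/eqP => E; move: euv'; rewrite E ei'.
apply: (lt_le_trans (pair_sum_add_pair es ei uv neuv d0 d3)).
have Sub : subrel e (add_pair e u v) by move=> x y E; rewrite /add_pair E.
have [||||||E|] := IH (add_pair e u v); last exact: ltW.
- exact: add_pair_sym.
- exact: add_pair_irr.
- move=> x y /or3P[/sub//|/andP[/eqP-> /eqP->]//|/andP[/eqP-> /eqP->]].
  by rewrite es'.
- by move=> x; rewrite rdeg_add_pair // -addnA addn_gt0 d0.
- move=> x y; rewrite !rdeg_add_pair // => /or3P[/d3|/andP[/eqP-> /eqP->]|/andP[/eqP-> /eqP->]].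
  + by lia.
  + by rewrite !eqxx; have := d0 u; have := d0 v; lia.
  + by rewrite !eqxx; have := d0 u; have := d0 v; lia.
- apply: leq_trans (proper_card _) cm; apply/properP; split.
    apply/subsetP => -[x y]; rewrite !inE /= => /andP[-> /= H].
    by apply: contra H; apply: Sub.
  by exists (u, v); rewrite !inE /= ?euv' ?neuv // /add_pair !eqxx orbT.
- by rewrite (pair_sum_eq E).
Qed.

Lemma sum_rdeg_le e (F : T -> T -> R) (D : nat) (w : R) : 0 <= w ->
  (forall x, (rdeg e x <= D)%N) -> (forall x y, e x y -> F x y <= w) ->
  \sum_x \sum_(y | e x y) F x y <= (#|T| * D)%:R * w.
Proof.
move=> w0 dD Fw.
apply: (@le_trans _ _ (\sum_(x : T) D%:R * w)).
  apply: ler_sum => x _; apply: (@le_trans _ _ (\sum_(y | e x y) w)).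
    by apply: ler_sum => y; apply: Fw.
  rewrite sumr_const -[_ *+ _]mulr_natl ler_wpM2r // ler_nat.
  by have := dD x; rewrite /rdeg cardsE.
by rewrite sumr_const natrM -mulrA -[_ *+ _]mulr_natl.
Qed.

End PairSum.

(** * The index as half a sum over ordered pairs *)

Lemma set2_eq (T : finType) (a b x y : T) :
  x != y -> [set x; y] = [set a; b] -> (x, y) = (a, b) \/ (x, y) = (b, a).
Proof.
move=> xy E.
have : x \in [set a; b] by rewrite -E set21.
have : y \in [set a; b] by rewrite -E set22.
rewrite !inE => /orP[]/eqP yE /orP[]/eqP xE; move: xy; rewrite xE yE ?eqxx //.
  by right.
by left.
Qed.

(** Group the ordered pairs by their underlying edge: each fibre consists of the two distinct pairs
    [(a, b)] and [(b, a)]. *)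
Lemma ASO_pair_sum (R : realType) (G : sgraph) :
  2 * ASO R G = pair_sum R (@adj G).
Proof.
rewrite /pair_sum pair_big_dep /=.
rewrite (partition_big (fun p => [set p.1; p.2]) (mem (edges G))) /=; last first.
  by move=> p pE; apply/imsetP; exists p; rewrite ?inE.
rewrite mulr_sumr; apply: eq_bigr => A /imsetP[[a b]]; rewrite inE /= => ab ->.
have aNb : a != b by apply/eqP => E; move: ab; rewrite E adj_irr.
rewrite (bigD1 (a, b)) /= ?ab ?eqxx //.
rewrite (bigD1 (b, a)) /=; last first.
  by rewrite adj_sym ab setUC eqxx xpair_eqE negb_and eq_sym aNb.
rewrite [X in _ = _ + (_ + X)]big1 => [|[x y]] /=; last first.
  move=> /andP[/andP[/andP[xy /eqP E] n1] n2].
  have xNy : x != y by apply/eqP => H; move: xy; rewrite H adj_irr.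
  by case: (set2_eq xNy E) => H; move: n1 n2; rewrite H eqxx.
rewrite addr0 [X in _ = _ + X]weightC mulr2n mulrDl mul1r /weight.
by rewrite !big_setU1 ?inE //= !big_set1.
Qed.

Lemma bin2_natr (R : realType) (k : nat) : 2 * 'C(k, 2)%:R = k%:R * (k%:R - 1) :> R.
Proof.
elim: k => [|k IH]; first by rewrite bin0n mulr0 mul0r.
by rewrite binS bin1 natrD mulrDr IH -natr1; ring.
Qed.

(** * The bound as a sum of weights, and a lower estimate for it *)

Section Bound.
Variable R : realType.

Definition ASO_bound (n k : nat) : R :=
  k%:R * Num.sqrt (((n%:R - 1) ^+ 2 + k%:R ^+ 2) / (n%:R + k%:R - 3))
  + 'C(k, 2)%:R * Num.sqrt (n%:R + 1 / (n%:R - 2))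
  + k%:R * (n%:R - k%:R - 1)
    * Num.sqrt (n%:R - 1 / 2 + 5 / (2 * (2 * n%:R - 5)))
  + 'C(n - k - 1, 2)%:R * Num.sqrt (n%:R - 1 + 1 / (n%:R - 3)).

(** Each radical is the weight of one class of edges of the extremal graph: the special vertex has
    degree [k], its neighbours [n - 1], the remaining vertices [n - 2]. *)
Lemma ASO_bound_weight n k : (4 <= n)%N -> (k <= n.-1)%N ->
  2 * ASO_bound n k =
  2 * k%:R * weight R k n.-1 + k%:R * (k%:R - 1) * weight R n.-1 n.-1
  + 2 * k%:R * (n%:R - 1 - k%:R) * weight R n.-1 n.-2
  + (n%:R - 1 - k%:R) * (n%:R - 2 - k%:R) * weight R n.-2 n.-2.
Proof.
move=> n4 kn.
have n4R : 4 <= n%:R :> R by rewrite ler_nat.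
have n1 : n.-1%:R = n%:R - 1 :> R by rewrite -subn1 natrB //; lia.
have n2 : n.-2%:R = n%:R - 2 :> R by rewrite -subn2 natrB //; lia.
have m1 : (n - k - 1)%:R = n%:R - 1 - k%:R :> R by rewrite !natrB; [ring|lia|lia].
rewrite /ASO_bound.
have -> : weight R k n.-1 = Num.sqrt (((n%:R - 1) ^+ 2 + k%:R ^+ 2) / (n%:R + k%:R - 3)).
  rewrite weightC /weight n1; congr (Num.sqrt (_ / _)); ring.
have -> : weight R n.-1 n.-1 = Num.sqrt (n%:R + 1 / (n%:R - 2)).
  rewrite /weight n1; congr Num.sqrt; field.
  by do ?[apply/andP; split]; apply: lt0r_neq0; lra.
have -> : weight R n.-1 n.-2 = Num.sqrt (n%:R - 1 / 2 + 5 / (2 * (2 * n%:R - 5))).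
  rewrite /weight n1 n2; congr Num.sqrt; field.
  by do ?[apply/andP; split]; apply: lt0r_neq0; lra.
have -> : weight R n.-2 n.-2 = Num.sqrt (n%:R - 1 + 1 / (n%:R - 3)).
  rewrite /weight n2; congr Num.sqrt; field.
  by do ?[apply/andP; split]; apply: lt0r_neq0; lra.
have -> : (n%:R - 1 - k%:R) * (n%:R - 2 - k%:R) = 2 * 'C(n - k - 1, 2)%:R :> R.
  by rewrite bin2_natr m1; ring.
by rewrite -bin2_natr; ring.
Qed.

(** Drop the [k] edges at the special vertex. The others form a complete graph on [n - 1] vertices,
    and each weighs at least [sqrt (n - 1)]. *)
Lemma ASO_bound_ge n k : (4 <= n)%N -> (1 <= k)%N -> (k <= n.-2)%N ->
  ((n.-1 * n.-2)%:R * Num.sqrt n.-1%:R) <= 2 * ASO_bound n k.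
Proof.
move=> n4 k1 kn.
have n4R : 4 <= n%:R :> R by rewrite ler_nat.
have n1 : n.-1%:R = n%:R - 1 :> R by rewrite -subn1 natrB //; lia.
have n2 : n.-2%:R = n%:R - 2 :> R by rewrite -subn2 natrB //; lia.
have k1R : 1 <= k%:R :> R by rewrite ler1n.
have knR : k%:R <= n%:R - 2 :> R by rewrite -n2 ler_nat.
rewrite ASO_bound_weight //; last lia.
have -> : n.-1%:R = n.-2%:R + 1 :> R by rewrite n1 n2; ring.
have /= wA := @weight_ge R n.-1 n.-1 n.-2.
have /= wB := @weight_ge R n.-1 n.-2 n.-2.
have /= wC := @weight_ge R n.-2 n.-2 n.-2.
have {}wA := wA ltac:(lia) ltac:(lia) ltac:(lia) ltac:(lia).
have {}wB := wB ltac:(lia) ltac:(lia) ltac:(lia) ltac:(lia).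
have {}wC := wC ltac:(lia) ltac:(lia) ltac:(lia) ltac:(lia).
move: (Num.sqrt _) wA wB wC => w wA wB wC.
rewrite natrM n1 n2.
have P0 : 0 <= 2 * k%:R * weight R k n.-1 by rewrite !mulr_ge0 ?weight_ge0.
have a0 : 0 <= k%:R * (k%:R - 1) :> R by rewrite mulr_ge0 // subr_ge0.
have b0 : 0 <= 2 * k%:R * (n%:R - 1 - k%:R) :> R by rewrite mulr_ge0 //; lra.
have c0 : 0 <= (n%:R - 1 - k%:R) * (n%:R - 2 - k%:R) :> R by rewrite mulr_ge0 //; lra.
have hA := ler_wpM2l a0 wA; have hB := ler_wpM2l b0 wB; have hC := ler_wpM2l c0 wC.
have -> : (n%:R - 1) * (n%:R - 2) * w = 0 + k%:R * (k%:R - 1) * w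
  + 2 * k%:R * (n%:R - 1 - k%:R) * w + (n%:R - 1 - k%:R) * (n%:R - 2 - k%:R) * w by ring.
by rewrite !lerD.
Qed.

End Bound.

(** * Graphs that are complete away from one vertex *)

(** Together with the degree of [v] this determines the graph up to isomorphism. It covers both
    extremal graphs, [K_n] being the case where [v] has degree [n - 1]. *)
Definition complete_off (T : finType) (e : rel T) (v : T) :=
  forall x y, x != v -> y != v -> x != y -> e x y.

Section CompleteOff.
Variables (T : finType) (e : rel T) (v : T).
Hypotheses (es : symmetric e) (ei : irreflexive e) (ec : complete_off e v).

Lemma complete_off_adj x y : x != v -> y != x ->
  e x y = if y == v then e v x else true.
Proof.
move=> xv yx; case: eqP => [->|/eqP yv]; first by rewrite es.
by rewrite ec // eq_sym.
Qed.

Lemma rdeg_complete_off_in x : e v x -> rdeg e x = #|T|.-1.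
Proof.
move=> vx; have xv : x != v by apply/eqP => E; move: vx; rewrite E ei.
rewrite -(cardC1 x) /rdeg -cardsE; apply: eq_card => y; rewrite !inE.
have [->|yx] := eqVneq y x; first by rewrite ei.
by rewrite complete_off_adj // vx if_same.
Qed.

Lemma rdeg_complete_off_out x : x != v -> ~~ e v x -> rdeg e x = #|T|.-2.
Proof.
move=> xv vx; have := cardsC [set x; v]; rewrite cards2 xv => E.
suff -> : rdeg e x = #|~: [set x; v]| by rewrite -E.
apply: eq_card => y; rewrite !inE.
have [->|yx] := eqVneq y x; first by rewrite ei.
rewrite complete_off_adj //.
by case: (y == v); rewrite ?(negbTE vx).
Qed.

Lemma big_complete_off (R : realType) (F : nat -> R) :
  \sum_y F (rdeg e y) = F (rdeg e v) + (rdeg e v)%:R * F #|T|.-1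
    + (#|T|%:R - 1 - (rdeg e v)%:R) * F #|T|.-2.
Proof.
have split3 (H : T -> R) :
    \sum_y H y = H v + \sum_(y | e v y) H y + \sum_(y | (y != v) && ~~ e v y) H y.
  rewrite (bigD1 v) //= -addrA (bigID (e v)) /=; congr (_ + (_ + _)).
  apply: eq_bigl => y; case: eqP => [->|//]; by rewrite ei.
(* The constant function 1 gives the number of non-neighbours of [v] other than [v]. *)
have := split3 (fun=> 1); rewrite !sumr_const.
rewrite (_ : #|[pred y | e v y]| = rdeg e v) => [cM|]; last by rewrite /rdeg cardsE.
have {}cM : #|[pred y | (y != v) && ~~ e v y]|%:R
    = #|T|%:R - 1 - (rdeg e v)%:R :> R.
  by rewrite cM; ring.
rewrite split3 -cM; congr (_ + _ + _).
  rewrite (eq_bigr (fun=> F #|T|.-1)) => [|y vy]; last by rewrite rdeg_complete_off_in.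
  by rewrite sumr_const /rdeg cardsE mulr_natl.
rewrite (eq_bigr (fun=> F #|T|.-2)) => [|y /andP[yv vy]]; last by rewrite rdeg_complete_off_out.
by rewrite sumr_const mulr_natl.
Qed.

Lemma pair_sum_complete_off (R : realType) : (4 <= #|T|)%N ->
  pair_sum R e = 2 * ASO_bound R #|T| (rdeg e v).
Proof.
move=> n4; set k := rdeg e v; set n := #|T|.
have kn : (k <= n.-1)%N.
  rewrite -(cardC1 v) /k /rdeg -cardsE subset_leq_card //.
  by apply/subsetP => y; rewrite !inE; apply: contraTneq => ->; rewrite ei.
rewrite ASO_bound_weight //.
pose rowsum c := weight R c k + k%:R * weight R c n.-1
  + (n%:R - 1 - k%:R) * weight R c n.-2.
(* [F d] is the row of a vertex [x != v] of degree [d]: the sum over all vertices minus the term of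
   [x] itself and, when [d = n - 2], also that of [v]. *)
pose F d : R := if d == n.-1 then rowsum n.-1 - weight R n.-1 n.-1
  else rowsum n.-2 - weight R n.-2 n.-2 - weight R n.-2 k.
have rowE c : \sum_y weight R c (rdeg e y) = rowsum c.
  exact: (big_complete_off (weight R c)).
have row x : x != v -> \sum_(y | e x y) weight R (rdeg e x) (rdeg e y) = F (rdeg e x).
  move=> xv; have [vx|vx] := boolP (e v x).
    rewrite rdeg_complete_off_in // /F eqxx -rowE [X in _ = X - _](bigD1 x) //=.
    rewrite rdeg_complete_off_in // addrC addrK; apply: eq_bigl => y.
    have [->|yx] := eqVneq y x; first by rewrite ei.
    by rewrite complete_off_adj // vx if_same.
  rewrite rdeg_complete_off_out // /F ifF; last by apply/eqP; rewrite -/n; lia.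
  rewrite -rowE [X in _ = X - _ - _](bigD1 x) //= [X in _ = _ + X - _ - _](bigD1 v) 1?eq_sym //=.
  rewrite rdeg_complete_off_out // -/k.
  rewrite (_ : forall a b c : R, a + (b + c) - a - b = c); last by move=> *; ring.
  apply: eq_bigl => y.
  have [->|yx] := eqVneq y x; first by rewrite ei.
  by rewrite complete_off_adj //; case: (y == v); rewrite ?(negbTE vx).
have rowv : \sum_(y | e v y) weight R k (rdeg e y) = k%:R * weight R k n.-1.
  rewrite (eq_bigr (fun=> weight R k n.-1)) => [|y vy]; last by rewrite rdeg_complete_off_in.
  by rewrite sumr_const /k /rdeg cardsE mulr_natl.
(* The summand [F k] contributed by [v] is not its row, so it is removed and the true row added. *)
have -> : pair_sum R e = k%:R * weight R k n.-1 + (\sum_y F (rdeg e y) - F k).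
  rewrite /pair_sum (bigD1 v) //= rowv; congr (_ + _).
  rewrite [X in _ = X - _](bigD1 v) //= [F _ + _]addrC addrK.
  by apply: eq_bigr => y yv; rewrite row.
have Fa : F n.-1 = rowsum n.-1 - weight R n.-1 n.-1 by rewrite /F eqxx.
have Fb : F n.-2 = rowsum n.-2 - weight R n.-2 n.-2 - weight R n.-2 k.
  by rewrite /F ifF //; apply/eqP; lia.
rewrite (big_complete_off F) -/k -/n Fa Fb /rowsum.
rewrite [weight R n.-1 k]weightC [weight R n.-2 n.-1]weightC.
by ring.
Qed.

End CompleteOff.

(** * Connectedness, cuts and edge connectivity *)

Section Connectivity.
Variable G : sgraph.
Implicit Types (S : {set G}) (x y v : G).

(** Pairs are oriented out of [S], so each crossing edge counts once. *)
Definition cut S : {set G * G} :=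
  [set p | [&& p.1 \in S, p.2 \notin S & adj p.1 p.2]].

Lemma connected_cut S x y : connected G -> x \in S -> y \notin S ->
  exists2 a, a \in S & exists2 b, b \notin S & adj a b.
Proof.
move=> /andP[_ /forallP/(_ x)/forallP/(_ y) xy] xS yS.
have [/existsP[[a b]]|/existsPn N] := boolP [exists p, p \in cut S].
  by rewrite inE /= => /and3P[aS bS ab]; exists a => //; exists b.
have cl : closed (@adj G) (mem S).
  apply: intro_closed; first exact/sym_connect_sym/adj_sym.
  move=> a b ab aS; apply/negPn/negP => bS.
  by have := N (a, b); rewrite inE /= aS bS ab.
by have := closed_connect cl xy; rewrite /= xS (negbTE yS).
Qed.

Lemma connected_degree_gt0 x : connected G -> (1 < #|G|)%N -> (0 < degree x)%N.
Proof.
move=> cG; rewrite (cardD1 x) ltnS => /card_gt0P[y]; rewrite !inE andbT => yx.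
have [||a /set1P-> [b _ xb]] := @connected_cut [set x] x y cG; rewrite ?inE //.
by apply/card_gt0P; exists b; rewrite inE.
Qed.

(** A third vertex forces an edge leaving [{x, y}], which gives one of the two a second neighbour.
    This keeps the denominators of the weights positive. *)
Lemma connected_degree_sum x y : connected G -> (2 < #|G|)%N -> adj x y ->
  (3 <= degree x + degree y)%N.
Proof.
move=> cG n2 xy.
have yNx : y != x by apply/eqP => E; move: xy; rewrite E adj_irr.
have [z zN] : exists z, z \notin [set x; y].
  apply/existsP; rewrite -negb_forall; apply: contraTN n2 => /forallP H.
  rewrite -leqNgt -(cardsT G) (leq_trans (subset_leq_card (B := [set x; y]) _)) //.
    by apply/subsetP.
  by rewrite cards2; case: (x != y).
have d1 (a b : G) : adj a b -> (0 < degree a)%N.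
  by move=> ab; apply/card_gt0P; exists b; rewrite inE.
have d2 (a b c : G) : adj a b -> adj a c -> c != b -> (1 < degree a)%N.
  move=> ab ac cb; rewrite /degree (cardsD1 b) inE ab ltnS.
  by apply/card_gt0P; exists c; rewrite !inE cb.
have dx := d1 _ _ xy; have dy : (0 < degree y)%N by apply: (d1 _ x); rewrite adj_sym.
have [|a aS [b]] := @connected_cut [set x; y] x z cG _ zN; first by rewrite set21.
rewrite !inE negb_or => /andP[bx bY] ab.
move: aS ab; rewrite !inE => /orP[]/eqP-> ab.
  by have := d2 x y b xy ab bY; lia.
by have := d2 y x b; rewrite adj_sym => /(_ xy ab bx); lia.
Qed.

End Connectivity.

Lemma disconnecting_isolated (G : sgraph) (F : {set {set G}}) (v : G) :
  (1 < #|G|)%N -> F \subset edges G -> (forall y, adj v y -> [set v; y] \in F) ->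
  disconnecting (G := G) F.
Proof.
move=> n1 sF vF; rewrite /disconnecting sF /=; apply/negP => cG.
have /= := @connected_degree_gt0 (del_edges F) v cG n1.
rewrite /degree => /card_gt0P[y]; rewrite inE /= /del_adj => /andP[/vF ->].
by [].
Qed.

Lemma mem_edges (G : sgraph) (x y : G) : adj x y -> [set x; y] \in edges G.
Proof. by move=> xy; apply/imsetP; exists (x, y); rewrite ?inE. Qed.

Lemma edge_connectivityP (G : sgraph) : (1 < #|G|)%N ->
  exists F : {set {set G}}, [/\ disconnecting (G := G) F, #|F| = edge_connectivity G &
    forall F', disconnecting (G := G) F' -> (edge_connectivity G <= #|F'|)%N].
Proof.
move=> n1; have /card_gt0P[v _] := ltnW n1.
have dE : disconnecting (G := G) (edges G).
  by apply: (@disconnecting_isolated _ _ v) => // y; apply: mem_edges.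
exists [arg min_(F < edges G | disconnecting F) #|F|]%N.
rewrite /edge_connectivity.
by case: (arg_minnP (fun F : {set {set G}} => #|F|) dE).
Qed.

Lemma edge_connectivity_le_degree (G : sgraph) (v : G) : (1 < #|G|)%N ->
  (edge_connectivity G <= degree v)%N.
Proof.
move=> n1; have [_ [_ _ minF]] := edge_connectivityP n1.
apply: leq_trans (leq_imset_card (fun y => [set v; y]) [set y | adj v y]).
apply/minF/(@disconnecting_isolated _ _ v) => //.
  by apply/subsetP => A /imsetP[y]; rewrite inE => /mem_edges vy ->.
by move=> y vy; apply/imsetP; exists y; rewrite ?inE.
Qed.

(** Take for [S] a component left after deleting a minimum disconnecting set [F]: every edge leaving
    [S] lies in [F]. *)
Lemma edge_connectivity_cut (G : sgraph) : (1 < #|G|)%N ->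
  exists (S : {set G}) x y, [/\ x \in S, y \notin S & (#|cut S| <= edge_connectivity G)%N].
Proof.
move=> n1; have [F [/andP[sF]]] := edge_connectivityP n1.
rewrite negb_and ltnW //= => /forallPn[x /forallPn[y xy]] <- _.
pose S := [set z | connect (@adj (del_edges F)) x z].
exists S, x, y; split; rewrite ?inE ?connect0 //.
have inF (a b : G) : a \in S -> b \notin S -> adj a b -> [set a; b] \in F.
  rewrite !inE => xa xb ab; apply: contraNT xb => abF.
  by apply: connect_trans xa (connect1 _); rewrite /= /del_adj ab.
rewrite -(@card_in_imset _ _ (fun p : G * G => [set p.1; p.2])).
  apply/subset_leq_card/subsetP => A /imsetP[[a b]]; rewrite inE /= => /and3P[aS bS ab] ->.
  exact: inF.
(* An edge determines its crossing pair, since only the first component lies in [S]. *)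
move=> [a b] [c d]; rewrite !inE /= => /and3P[aS bS ab] /and3P[cS dS cd] E.
have aNb : a != b by apply/eqP => H; move: ab; rewrite H adj_irr.
case: (set2_eq aNb E) => // -[H _].
by move: dS; rewrite -H aS.
Qed.

(** * Sizes of the sides of a minimum cut when no degree equals the edge connectivity *)

Section CutBounds.
Variable G : sgraph.
Implicit Types (S : {set G}) (x y v : G).

Lemma card_cut S :
  #|cut S| = (\sum_(x in S) #|[set y | (y \notin S) && adj x y]|)%N.
Proof.
rewrite -sum1_card.
under [RHS]eq_bigr do rewrite -sum1_card.
by rewrite pair_big_dep /=; apply: eq_bigl => p; rewrite !inE.
Qed.

Lemma card_cutC S : (#|cut (~: S)| <= #|cut S|)%N.
Proof.
apply: leq_trans (leq_imset_card (fun p => (p.2, p.1)) (cut S)).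
apply/subset_leq_card/subsetP => -[a b]; rewrite !inE /= negbK => /and3P[aS bS ab].
by apply/imsetP; exists (b, a); rewrite // inE /= bS aS adj_sym.
Qed.

Lemma degree_cut S x : x \in S ->
  (degree x <= #|S|.-1 + #|[set y | (y \notin S) && adj x y]|)%N.
Proof.
move=> xS; rewrite /degree -(cardsID S); apply: leq_add.
  rewrite [#|S|](cardsD1 x) xS /=; apply/subset_leq_card/subsetP => y.
  rewrite !inE => /andP[xy ->]; rewrite andbT; apply: contraTneq xy => ->.
  by rewrite adj_irr.
by apply/subset_leq_card/subsetP => y; rewrite !inE.
Qed.

Lemma degree_cut_card S x : x \in S -> (degree x <= #|S|.-1 + #|cut S|)%N.
Proof.
move=> xS; apply: leq_trans (degree_cut xS) _.
by rewrite leq_add2l card_cut (bigD1 x) //= leq_addr.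
Qed.

(* Summing degrees over [S] gives [s (k + 1) <= s (s - 1) + k], which fails for
   [1 <= s <= k + 1]. *)
Lemma card_side_ge S x k : x \in S -> (#|cut S| <= k)%N ->
  (forall y, (k < degree y)%N) -> (k.+2 <= #|S|)%N.
Proof.
move=> xS cS dk.
have S0 : (0 < #|S|)%N by apply/card_gt0P; exists x.
have h : (#|S| * k.+1 <= #|S| * #|S|.-1 + k)%N.
  apply: leq_trans (leq_add (leqnn _) cS).
  rewrite card_cut -!sum_nat_const -big_split /=.
  by apply: leq_sum => y yS; apply: leq_trans (dk y) (degree_cut yS).
by rewrite ltnNge; apply/negP => Sk; nia.
Qed.

(** All degrees exceed [k >= 1], so each side has at least [k + 2] vertices. A vertex has at most
    [k] neighbours across and at most [n - (k + 2) - 1] on its own side, hence degree at most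
    [n - 3]. *)
Lemma degree_bounds k : connected G -> (1 < #|G|)%N -> edge_connectivity G = k ->
  (forall x, degree x != k) ->
  (0 < k /\ 2 * k + 4 <= #|G|)%N /\
  forall x, (2 <= degree x <= #|G| - 3)%N.
Proof.
move=> cG n1 ek dNk.
have dk x : (k < degree x)%N.
  by rewrite ltn_neqAle eq_sym dNk -ek edge_connectivity_le_degree.
have [S [a [b [aS bS cS]]]] := edge_connectivity_cut n1; rewrite ek in cS.
have k0 : (0 < k)%N.
  have [x xS [y yS xy]] := connected_cut cG aS bS.
  by apply: leq_trans cS; apply/card_gt0P; exists (x, y); rewrite inE /= xS yS.
have bS' : b \in ~: S by rewrite inE.
have cS' : (#|cut (~: S)| <= k)%N by apply: leq_trans (card_cutC S) cS.
have h1 := card_side_ge aS cS dk; have h2 := card_side_ge bS' cS' dk.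
have h3 := cardsC S.
split; first by lia.
move=> x; have := dk x; have [xS|xS] := boolP (x \in S).
  by have := degree_cut_card xS; lia.
have xS' : x \in ~: S by rewrite inE.
by have := degree_cut_card xS'; lia.
Qed.

End CutBounds.

(** * The upper bound and its equality case *)

Section Extremal.
Variables (R : realType) (G : sgraph).

Lemma ASO_complete_off v : (4 <= #|G|)%N -> complete_off (@adj G) v ->
  ASO R G = ASO_bound R #|G| (degree v).
Proof.
move=> n4 cv; apply: (@mulfI R 2); first by rewrite pnatr_eq0.
by rewrite ASO_pair_sum (pair_sum_complete_off (@adj_sym G) (@adj_irr G) cv).
Qed.

(** The largest supergraph of [G] in which [v] keeps its neighbourhood. *)
Definition fill_off v : rel G :=
  fun x y => (x != y) && [|| (x != v) && (y != v) | adj x y].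

Lemma ASO_fill_off v : (4 <= #|G|)%N -> connected G ->
  complete_off (@adj G) v \/ ASO R G < ASO_bound R #|G| (degree v).
Proof.
move=> n4 cG.
have fs : symmetric (fill_off v).
  by move=> x y; rewrite /fill_off eq_sym adj_sym [(y != v) && _]andbC.
have fi : irreflexive (fill_off v) by move=> x; rewrite /fill_off eqxx.
have fc : complete_off (fill_off v) v.
  by move=> x y xv yv xy; rewrite /fill_off xy xv yv.
have dv : rdeg (fill_off v) v = degree v.
  apply: eq_card => y; rewrite !inE /fill_off eqxx /=.
  by case: eqVneq => [<-|]; rewrite ?adj_irr.
have sub : subrel (@adj G) (fill_off v).
  move=> x y xy; rewrite /fill_off xy orbT andbT.
  by apply: contraTneq xy => ->; rewrite adj_irr.
have n1 : (1 < #|G|)%N by lia.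
have n2 : (2 < #|G|)%N by lia.
case: (@pair_sum_subrel R G _ _ (@adj_sym G) (@adj_irr G) fs fi sub) => [x|x y xy|E|lt].
- exact: connected_degree_gt0.
- exact: connected_degree_sum.
- by left=> x y xv yv xy; rewrite E fc.
- right; move: lt; rewrite -ASO_pair_sum (pair_sum_complete_off fs fi fc) // dv.
  by rewrite ltr_pM2l.
Qed.

Lemma ASO_lt_no_min_degree : (4 <= #|G|)%N -> connected G ->
  (forall x : G, degree x != edge_connectivity G) ->
  ASO R G < ASO_bound R #|G| (edge_connectivity G).
Proof.
move=> n4 cG dNk; have n1 : (1 < #|G|)%N by lia.
have [[k0 kn] dB] := degree_bounds cG n1 erefl dNk.
rewrite -(ltr_pM2l (x := 2)) // ASO_pair_sum.
have := @ASO_bound_ge R #|G| _ n4 k0; move/(_ ltac:(lia)).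
apply: lt_le_trans.
(* This matches [weight_le] with [D = n - 3]. *)
have E : #|G|.-1%:R = (#|G| - 3)%:R + 2 :> R by rewrite -natrD; congr _%:R; lia.
apply: (@le_lt_trans _ _ ((#|G| * (#|G| - 3))%:R * Num.sqrt #|G|.-1%:R)).
  apply: sum_rdeg_le => [|x|x y _]; first exact: sqrtr_ge0.
    by case/andP: (dB x).
  by rewrite E; apply: weight_le; apply: dB.
(* Strict because [n (n - 3) = (n - 1) (n - 2) - 2]. *)
by rewrite ltr_pM2r ?sqrtr_gt0 ?ltr0n ?ltr_nat; nia.
Qed.

Lemma ASO_le_bound : (4 <= #|G|)%N -> connected G ->
  ASO R G <= ASO_bound R #|G| (edge_connectivity G) /\
  (ASO R G = ASO_bound R #|G| (edge_connectivity G) <->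
   exists2 v : G, degree v = edge_connectivity G & complete_off (@adj G) v).
Proof.
move=> n4 cG.
have ext (v : G) : degree v = edge_connectivity G -> complete_off (@adj G) v ->
    ASO R G = ASO_bound R #|G| (edge_connectivity G).
  by move=> <-; apply: ASO_complete_off.
have [/existsP[v /eqP dv]|/existsPn dNk] :=
    boolP [exists x : G, degree x == edge_connectivity G].
  have [cv|lt] := ASO_fill_off v n4 cG.
    by rewrite (ext v) //; split=> //; split=> // _; exists v.
  rewrite dv in lt; split; first exact: ltW.
  split=> [E|[w dw cw]]; first by move: lt; rewrite E ltxx.
  exact: ext cw.
have lt := ASO_lt_no_min_degree n4 cG dNk; split; first exact: ltW.
split=> [E|[w dw cw]]; first by move: lt; rewrite E ltxx.
exact: ext cw.
Qed.

End Extremal.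

(** * Isomorphism with the extremal graphs *)

Section Isomorphism.
Variable G : sgraph.

Lemma giso_of_inj (H : sgraph) (g : H -> G) : injective g -> (#|G| <= #|H|)%N ->
  (forall a b, adj (g a) (g b) = adj a b) -> giso G H.
Proof.
move=> gi c gE; have [f fK gK] := inj_card_bij gi c.
by exists f; [exists g | move=> x y; rewrite -gE !gK].
Qed.

Lemma degree_giso (H : sgraph) (f : G -> H) v : bijective f ->
  (forall x y, adj (f x) (f y) = adj x y) -> degree v = degree (f v).
Proof.
move=> fb fE; rewrite /degree -(card_imset _ (bij_inj fb)); apply: eq_card => z.
have [g fK gK] := fb; rewrite inE -[z]gK fE mem_imset ?inE //.
exact: can_inj fK.
Qed.

Lemma degree_complete m (i : complete m) : degree i = m.-1.
Proof.
rewrite -[in RHS](card_ord m) -(cardC1 i) -cardsE.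
by apply: eq_card => j; rewrite !inE /= /complete_adj eq_sym.
Qed.

Lemma complete_off_giso_complete : (0 < #|G|)%N ->
  (exists2 v : G, degree v = #|G|.-1 & complete_off (@adj G) v) <->
  giso G (complete #|G|).
Proof.
move=> n0; split=> [[v dv cv]|[f fb fE]].
  (* The neighbourhood of [v] lies in the complement of [v] and has the same size [n - 1]. *)
  have vA y : y != v -> adj v y.
    have : [set y | adj v y] == [set~ v].
      rewrite eqEcard cardsC1 -/(degree v) dv leqnn andbT.
      apply/subsetP => z; rewrite !inE; apply: contraTneq => ->.
      by rewrite adj_irr.
    by move=> /eqP/setP/(_ y); rewrite !inE => ->.
  apply: (@giso_of_inj (complete #|G|) enum_val).
  - exact: enum_val_inj.
  - by rewrite /= card_ord.
  move=> a b; rewrite /= /complete_adj -(inj_eq enum_val_inj).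
  move: (enum_val a) (enum_val b) => x y; have [->|xy] := eqVneq; first by rewrite adj_irr.
  have [E|xv] := eqVneq x v; first by rewrite E vA // -E eq_sym.
  have [->|yv] := eqVneq y v; first by rewrite adj_sym vA.
  by rewrite cv.
have /card_gt0P[v _] := n0; exists v; first by rewrite (degree_giso _ fb fE) degree_complete.
by move=> x y _ _; rewrite -fE /= /complete_adj (inj_eq (bij_inj fb)).
Qed.

Lemma complete_off_giso_join k : (k < #|G|)%N ->
  (exists2 v : G, degree v = k & complete_off (@adj G) v) <->
  giso G (gjoin (gunion (complete 1) (complete (#|G| - k - 1))) (complete k)).
Proof.
move=> kn; split=> [[v dv cv]|[f fb fE]].
  (* [v] plays the part of [K_1], [M] that of [K_(n-k-1)] and [N] that of [K_k]. *)
  pose N := [set y | adj v y]; pose M := [set y | (y != v) && ~~ adj v y].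
  have cN : k = #|N| by rewrite -dv.
  have cM : (#|G| - k - 1 = #|M|)%N.
    suff -> : M = ~: (v |: N) by have := cardsC (v |: N); rewrite cardsU1 inE adj_irr -cN; lia.
    by apply/setP => y; rewrite !inE negb_or.
  pose g (z : gjoin (gunion (complete 1) (complete (#|G| - k - 1))) (complete k)) : G :=
    match z with
    | inl (inl _) => v
    | inl (inr i) => enum_val (cast_ord cM i)
    | inr i => enum_val (cast_ord cN i)
    end.
  have gM i : (enum_val (cast_ord cM i) != v) && ~~ adj v (enum_val (cast_ord cM i)).
    by have := enum_valP (cast_ord cM i); rewrite inE.
  have gN i : adj v (enum_val (cast_ord cN i)).
    by have := enum_valP (cast_ord cN i); rewrite inE.
  have gNv i : enum_val (cast_ord cN i) != v.
    by apply: contraTneq (gN i) => ->; rewrite adj_irr.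
  have MN i j : enum_val (cast_ord cM i) != enum_val (cast_ord cN j).
    have /andP[_] := gM i; apply: contraNneq => ->; exact: gN.
  apply: (@giso_of_inj _ g).
  - move=> [[a|a]|a] [[b|b]|b] //= E.
    + by rewrite (ord1 a) (ord1 b).
    + by have := gM b; rewrite -E eqxx.
    + by have := gNv b; rewrite -E eqxx.
    + by have := gM a; rewrite E eqxx.
    + by rewrite (cast_ord_inj (enum_val_inj E)).
    + by have := MN a b; rewrite E eqxx.
    + by have := gNv a; rewrite E eqxx.
    + by have := MN b a; rewrite E eqxx.
    + by rewrite (cast_ord_inj (enum_val_inj E)).
  - by rewrite /= !card_sum !card_ord; lia.
  have inside (x y : G) : x != v -> y != v -> adj x y = (x != y).
    by move=> xv yv; have [->|xy] := eqVneq x y; rewrite ?adj_irr ?cv.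
  move=> [[a|a]|a] [[b|b]|b] /=.
  + by rewrite adj_irr (ord1 a) (ord1 b).
  + by case/andP: (gM b) => _ /negbTE.
  + exact: gN.
  + by rewrite adj_sym; case/andP: (gM a) => _ /negbTE.
  + have /andP[av _] := gM a; have /andP[bv _] := gM b.
    by rewrite inside // (inj_eq enum_val_inj) (inj_eq (@cast_ord_inj _ _ _)).
  + by have /andP[av _] := gM a; rewrite inside // MN.
  + by rewrite adj_sym gN.
  + by have /andP[bv _] := gM b; rewrite inside // eq_sym MN.
  + by rewrite inside // (inj_eq enum_val_inj) (inj_eq (@cast_ord_inj _ _ _)).
have [g fK gK] := fb.
(* The preimage of the vertex of [K_1], whose neighbours are exactly the [k] vertices of [K_k]. *)
exists (g (inl (inl ord0))).
  rewrite (degree_giso _ fb fE) gK /degree.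
  pose h (i : 'I_k) :
    gjoin (gunion (complete 1) (complete (#|G| - k - 1))) (complete k) := inr i.
  have h_inj : injective h by move=> i j [].
  rewrite -[RHS]card_ord -(cardsT 'I_k) -(card_imset _ h_inj).
  apply: eq_card => -[[z|z]|z]; rewrite !inE /=.
  - by rewrite (ord1 z) /complete_adj eqxx; apply/esym/imsetP => -[].
  - by apply/esym/imsetP => -[].
  - by apply/esym/imsetP; exists z; rewrite ?inE.
move=> x y xv yv xy; rewrite -fE.
have fv z : z != g (inl (inl ord0)) -> f z != inl (inl ord0).
  by apply: contraNneq => <-; rewrite fK.
have := fv x xv; have := fv y yv.
have : f x != f y by rewrite (inj_eq (bij_inj fb)).
(* The only distinct non-adjacent pairs join [K_1] to [K_(n-k-1)], and neither [f x] nor [f y] is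
   the vertex of [K_1]. *)
case: (f x) => [[a|a]|a]; case: (f y) => [[b|b]|b] //=.
  by rewrite (ord1 a) eqxx.
by rewrite (ord1 b) eqxx.
Qed.

End Isomorphism.

Theorem theorem4 (R : realType) (G : sgraph) (n k : nat)
    (hn : (4 <= n)%N) (hG : #|G| = n) (hconn : connected G)
    (hk : edge_connectivity G = k) :
  let bound : R :=
    k%:R * Num.sqrt (((n%:R - 1) ^+ 2 + k%:R ^+ 2) / (n%:R + k%:R - 3))
    + 'C(k, 2)%:R * Num.sqrt (n%:R + 1 / (n%:R - 2))
    + k%:R * (n%:R - k%:R - 1)
      * Num.sqrt (n%:R - 1 / 2 + 5 / (2 * (2 * n%:R - 5)))
    + 'C(n - k - 1, 2)%:R * Num.sqrt (n%:R - 1 + 1 / (n%:R - 3)) in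
  [/\ ASO R G <= bound,
      (k <= n - 2)%N ->
        (ASO R G = bound <->
         giso G (gjoin (gunion (complete 1) (complete (n - k - 1)))
                       (complete k)))
    & k = (n - 1)%N -> (ASO R G = bound <-> giso G (complete n))].
Proof.
move=> bound; subst n k.
have n4 : (4 <= #|G|)%N by [].
have [le_bound eq_bound] := ASO_le_bound R n4 hconn.
split=> [|kn|kn].
- exact: le_bound.
- rewrite -complete_off_giso_join; last lia.
  exact: eq_bound.
- rewrite -complete_off_giso_complete; last lia.
  by rewrite -subn1 -kn; exact: eq_bound.
Qed.
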